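(* Let $\mathcal C$ be a centrally-symmetric $(2,2)$ correspondence given by $$Q(x,y)=a_{22}x^2y^2+a_{11}xy+a_{20}x^2+a_{02}y^2+a_{00}=0,$$ with $a_{11}\neq0$. Let $\hat{\mathcal C}$ be its secondary $(2,2)$ correspondence $$a_{22}^2u^2v^2+2a_{22}a_{20}u^2v+2a_{22}a_{02}uv^2+(2a_{22}a_{00}+2a_{02}a_{20}-a_{11}^2)uv+a_{20}^2u^2+a_{02}^2v^2+2a_{20}a_{00}u+2a_{02}a_{00}v+a_{00}^2=0.$$ Then $\mathcal C$ is $k$-semi-periodic if and only if it is not $k$-periodic and $\hat{\mathcal C}$ is $k$-periodic.
   Context: A $(2,2)$ correspondence is a curve in $\mathbb P^1\times\mathbb P^1$ given by a polynomial of degree two in each variable. Its horizontal switch $h$ exchanges the two points of the curve with the same second coordinate, its vertical switch $v$ exchanges the two points with the same first coordinate, and its QRT transformation is $\delta=v\circ h$. The correspondence is $k$-periodic if $\delta^k=\mathrm{Id}$. A centrally symmetric $(2,2)$ correspondence (invariant under $(x,y)\mapsto(-x,-y)$) is $k$-semi-periodic if the $k$-th iterate $\delta^k$ of its QRT transformation is the symmetry $(x,y)\mapsto(-x,-y)$ with respect to the origin. The secondary correspondence arises by squaring $a_{22}x^2y^2+a_{20}x^2+a_{02}y^2+a_{00}=-a_{11}xy$ and substituting $u=x^2$, $v=y^2$. *)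

(* Defs.v *)
From HB Require Import structures.
From mathcomp Require Import all_boot all_order all_algebra.
From mathcomp Require Import ring.

Set Implicit Arguments.
Unset Strict Implicit.
Unset Printing Implicit Defensive.

Import Order.TTheory GRing.Theory Num.Theory.
Local Open Scope ring_scope.

(* The projective line C ∪ {oo}, with None as the point at infinity. *)
Definition P1 (C : numClosedFieldType) : Type := option C.

Definition hcoord (C : numClosedFieldType) (x : P1 C) : C * C :=
  if x is Some t then (t, 1) else (1, 0).

(* The matrix a stands for the polynomial \sum_(i, j < 3) a i j x^i y^j. *)
Definition correspondence (C : numClosedFieldType) : Type := 'M[C]_3.

Definition biform (C : numClosedFieldType) (a : correspondence C)
    (x y : C * C) : C :=
  \sum_(i < 3) \sum_(j < 3)
     a i j * (x.1 ^+ i * x.2 ^+ (2 - i)) * (y.1 ^+ j * y.2 ^+ (2 - j)).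

Definition on_curve (C : numClosedFieldType) (a : correspondence C)
    (p : P1 C * P1 C) : Prop :=
  biform a (hcoord p.1) (hcoord p.2) = 0.

(* hswitch a p q: p and q are the two points of the curve with second
   coordinate p.2, with p = q when that fibre is a single (double) point.
   If the curve contains the whole horizontal line through p, that fibre is
   infinite and p has no image. *)
Definition hswitch (C : numClosedFieldType) (a : correspondence C)
    (p q : P1 C * P1 C) : Prop :=
  q.2 = p.2 /\ forall x : P1 C, on_curve a (x, p.2) <-> x = p.1 \/ x = q.1.

Definition vswitch (C : numClosedFieldType) (a : correspondence C)
    (p q : P1 C * P1 C) : Prop :=
  q.1 = p.1 /\ forall y : P1 C, on_curve a (p.1, y) <-> y = p.2 \/ y = q.2.

Definition qrt (C : numClosedFieldType) (a : correspondence C)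
    (p q : P1 C * P1 C) : Prop :=
  exists2 m, hswitch a p m & vswitch a m q.

Fixpoint qrt_iter (C : numClosedFieldType) (a : correspondence C) (k : nat)
    (p q : P1 C * P1 C) : Prop :=
  if k is k'.+1 then exists2 m, qrt a p m & qrt_iter a k' m q else q = p.

(* qrt_iter is single-valued (qrt_iter_fun below), so these say that the k-th
   iterate is defined at every point of the curve and has the given value. *)
Definition periodic (C : numClosedFieldType) (a : correspondence C)
    (k : nat) : Prop :=
  forall p, on_curve a p -> qrt_iter a k p p.

Definition central_sym (C : numClosedFieldType) (p : P1 C * P1 C) :
    P1 C * P1 C :=
  (omap -%R p.1, omap -%R p.2).

Definition semi_periodic (C : numClosedFieldType) (a : correspondence C)
    (k : nat) : Prop :=
  forall p, on_curve a p -> qrt_iter a k p (central_sym p).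

Definition corr_of_rows (C : numClosedFieldType) (s : seq (seq C)) :
    correspondence C :=
  \matrix_(i < 3, j < 3) nth 0 (nth [::] s i) j.

Definition primary (C : numClosedFieldType) (a22 a11 a20 a02 a00 : C) :
    correspondence C :=
  corr_of_rows [:: [:: a00;  0;  a02];
                   [::   0; a11;   0];
                   [:: a20;  0;  a22]].

Definition secondary (C : numClosedFieldType) (a22 a11 a20 a02 a00 : C) :
    correspondence C :=
  corr_of_rows
    [:: [:: a00 ^+ 2;
            2 * a02 * a00;
            a02 ^+ 2];
        [:: 2 * a20 * a00;
            2 * a22 * a00 + 2 * a02 * a20 - a11 ^+ 2;
            2 * a22 * a02];
        [:: a20 ^+ 2;
            2 * a22 * a20;
            a22 ^+ 2]].

Lemma primaryE (C : numClosedFieldType) (a22 a11 a20 a02 a00 x y : C) :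
  on_curve (primary a22 a11 a20 a02 a00) (Some x, Some y) <->
  a22 * x ^+ 2 * y ^+ 2 + a11 * x * y + a20 * x ^+ 2 + a02 * y ^+ 2 + a00 = 0.
Proof.
rewrite /on_curve /biform /= !big_ord_recl !big_ord0 !mxE /= /bump /= !expr1n.
set l := (X in X = 0); set r := (X in _ <-> X = 0).
by suff -> : l = r by []; rewrite /l /r !addn0; ring.
Qed.

Lemma secondaryE (C : numClosedFieldType) (a22 a11 a20 a02 a00 u v : C) :
  on_curve (secondary a22 a11 a20 a02 a00) (Some u, Some v) <->
  a22 ^+ 2 * u ^+ 2 * v ^+ 2 + 2 * a22 * a20 * u ^+ 2 * v
  + 2 * a22 * a02 * u * v ^+ 2
  + (2 * a22 * a00 + 2 * a02 * a20 - a11 ^+ 2) * u * v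
  + a20 ^+ 2 * u ^+ 2 + a02 ^+ 2 * v ^+ 2
  + 2 * a20 * a00 * u + 2 * a02 * a00 * v + a00 ^+ 2 = 0.
Proof.
rewrite /on_curve /biform /= !big_ord_recl !big_ord0 !mxE /= /bump /= !expr1n.
set l := (X in X = 0); set r := (X in _ <-> X = 0).
by suff -> : l = r by []; rewrite /l /r !addn0; ring.
Qed.

Lemma primary_central_sym (C : numClosedFieldType) (a22 a11 a20 a02 a00 : C)
    (p : P1 C * P1 C) :
  on_curve (primary a22 a11 a20 a02 a00) p ->
  on_curve (primary a22 a11 a20 a02 a00) (central_sym p).
Proof.
rewrite /on_curve /biform !big_ord_recl !big_ord0 !mxE /= /bump /=.
by case: p => -[x|] [y|] /= H; rewrite -[RHS]H; ring.
Qed.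

Lemma pair_set_fun (T : Type) (P : T -> Prop) (x y z : T) :
  (forall t, P t <-> t = x \/ t = y) -> (forall t, P t <-> t = x \/ t = z) ->
  y = z.
Proof.
move=> Py Pz; have [yx|//] := (Pz y).1 ((Py y).2 (or_intror erefl)).
by have [zx|//] := (Py z).1 ((Pz z).2 (or_intror erefl)); rewrite yx zx.
Qed.

Lemma qrt_fun (C : numClosedFieldType) (a : correspondence C)
    (p q q' : P1 C * P1 C) : qrt a p q -> qrt a p q' -> q = q'.
Proof.
case=> -[m1 m2] [/= -> hm] [vm vq] [[n1 n2] [/= -> hn] [vn vq']].
move: vm vq vn vq'; rewrite /= -(pair_set_fun hm hn) {hm hn}.
by case: q q' => [q1 q2] [r1 r2] /= -> vq -> /(pair_set_fun vq) ->.
Qed.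

Lemma qrt_iter_fun (C : numClosedFieldType) (a : correspondence C) (k : nat)
    (p q q' : P1 C * P1 C) :
  qrt_iter a k p q -> qrt_iter a k p q' -> q = q'.
Proof.
elim: k p => [|k IHk] p /=; first by move=> -> ->.
by case=> m pm mq [m' /(qrt_fun pm) <-]; apply: IHk.
Qed.

(* Main.v *)
(* The map (x, y) |-> (x^2, y^2) semiconjugates the QRT transformation of the
   primary correspondence to that of the secondary one, and two points of the
   primary curve with the same image are equal or opposite, since a11 <> 0. So
   if the secondary correspondence is k-periodic, the curve is the union of
   S_e = {p | \delta^k p = e p} for e = 1, -1, and it remains to see that one of
   the two is everything. The curve may be reducible, so irreducibility is not
   available; but S_e is a union of horizontal fibres, because
   h \delta^k h = \delta^(-k). Parametrising the curve by (eta, s) with eta the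
   second coordinate and s^2 the discriminant of the fibre, \delta^k is given
   near each point by polynomials f0(eta) + f1(eta) s. If some point lies
   outside S_e, one such polynomial is nonzero there and vanishes at
   (eta, s) and (eta, -s) over S_e, hence S_e contains only finitely many
   fibres; this cannot hold for both e. *)
Require Import Defs.
From mathcomp Require Import all_boot all_order all_algebra.
From mathcomp Require Import ring.
Import Order.TTheory GRing.Theory Num.Theory.
Local Open Scope ring_scope.

Set Implicit Arguments.
Unset Strict Implicit.
Unset Printing Implicit Defensive.

(** * Fibres as binary quadratic forms in homogeneous coordinates *)

Definition scal (C : numClosedFieldType) (l : C) (v : C * C) : C * C :=
  (l * v.1, l * v.2).

Definition cross (C : numClosedFieldType) (v w : C * C) : C :=
  v.1 * w.2 - v.2 * w.1.

Lemma cross_hcoord (C : numClosedFieldType) (x y : P1 C) :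
  cross (hcoord x) (hcoord y) = 0 <-> x = y.
Proof.
rewrite /cross; case: x y => [x|] [y|] /=; split=> //.
- by move=> H; congr Some; apply: subr0_eq; rewrite -[RHS]H; ring.
- by case=> ->; ring.
- by move/eqP; rewrite mul1r mulr0 sub0r oppr_eq0 oner_eq0.
- by move/eqP; rewrite mul1r mul0r subr0 oner_eq0.
- by move=> _; ring.
Qed.

(** The conditional matches the boolean that selects between two formulas in [hstep] and
    [fibre_root]: it makes the scalar factor of the selected one nonzero. *)
Lemma hcoord_pick (C : numClosedFieldType) (x : P1 C) :
  (if (hcoord x).2 != 0 then (hcoord x).2 else (hcoord x).1) != 0.
Proof. by case: x => [x|] /=; rewrite ?oner_neq0 ?eqxx /= ?oner_neq0. Qed.

Definition hcoef (C : numClosedFieldType) (a : correspondence C) (i : 'I_3)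
    (y : C * C) : C :=
  \sum_(j < 3) a i j * (y.1 ^+ j * y.2 ^+ (2 - j)).

Local Notation i0 := (ord0 : 'I_3).
Local Notation i1 := (lift ord0 ord0 : 'I_3).
Local Notation i2 := (lift ord0 (lift ord0 ord0) : 'I_3).

Lemma hcoefE (C : numClosedFieldType) (a : correspondence C) i y :
  hcoef a i y =
  a i i0 * y.2 ^+ 2 + a i i1 * (y.1 * y.2) + a i i2 * y.1 ^+ 2.
Proof.
rewrite /hcoef !big_ord_recl big_ord0 /= /bump /=.
by rewrite !expr0 !expr1 addr0 mul1r mulr1 addrA.
Qed.

Lemma biformE (C : numClosedFieldType) (a : correspondence C) x y :
  biform a x y = hcoef a i2 y * x.1 ^+ 2 + hcoef a i1 y * (x.1 * x.2)
                 + hcoef a i0 y * x.2 ^+ 2.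
Proof.
rewrite /biform !hcoefE !big_ord_recl !big_ord0 /= /bump /=.
by rewrite !expr0 !expr1 /=; ring.
Qed.

(** The form over [y] is c times the product of the linear forms vanishing at [p] and [q], compared
    coefficient by coefficient, so a double point counts twice. *)
Definition factored (C : numClosedFieldType) (a : correspondence C)
    (y : P1 C) (c : C) (p q : P1 C) : Prop :=
  let v := hcoord p in let w := hcoord q in
  [/\ hcoef a i2 (hcoord y) = c * (v.2 * w.2),
      hcoef a i1 (hcoord y) = - (c * (v.1 * w.2 + v.2 * w.1)) &
      hcoef a i0 (hcoord y) = c * (v.1 * w.1)].

Definition fibre_neq0 (C : numClosedFieldType) (a : correspondence C)
    (y : P1 C) : bool :=
  [|| hcoef a i2 (hcoord y) != 0, hcoef a i1 (hcoord y) != 0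
    | hcoef a i0 (hcoord y) != 0].

Lemma factored_on_curve (C : numClosedFieldType) (a : correspondence C) y c p q :
  c != 0 -> factored a y c p q ->
  forall x, on_curve a (x, y) <-> x = p \/ x = q.
Proof.
move=> c0 [HA HB HC] x; rewrite /on_curve biformE HA HB HC /=.
set l := (X in X = 0).
have -> : l = c * (cross (hcoord x) (hcoord p) * cross (hcoord x) (hcoord q)).
  by rewrite /l /cross; ring.
rewrite -!cross_hcoord; split=> [/eqP|].
  by rewrite !mulf_eq0 (negPf c0) /= => /orP[] /eqP; [left|right].
by case=> ->; rewrite ?(mul0r, mulr0).
Qed.

Lemma on_curve_factored (C : numClosedFieldType) (a : correspondence C) y p :
  fibre_neq0 a y -> on_curve a (p, y) ->
  exists2 c, c != 0 & exists q, factored a y c p q.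
Proof.
rewrite /fibre_neq0 /on_curve biformE /factored /=.
move: (hcoef a i2 _) (hcoef a i1 _) (hcoef a i0 _) => A B D.
case: p => [x|] /=.
- have [->|A0] := eqVneq A 0.
    rewrite mul0r add0r expr1n !mulr1 => /= H xD.
    have DE : D = - (B * x) by apply: subr0_eq; rewrite -[RHS]xD; ring.
    have B0 : B != 0.
      by case/orP: H => //; rewrite DE oppr_eq0 mulf_eq0 negb_or => /andP[].
    exists (- B); first by rewrite oppr_eq0.
    by exists None; split=> /=; rewrite ?DE; ring.
  (* The other root comes from the sum of the roots, - B / A. *)
  move=> _ xD; exists A => //; exists (Some (- (B / A) - x)).
  have DE : D = - (A * x ^+ 2 + B * x).
    by apply: subr0_eq; rewrite -[RHS]xD; ring.
  by split=> /=; rewrite ?DE; field.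
- rewrite expr1n !mulr1 !mulr0 expr0n /= mulr0 !addr0 => H A0; subst A.
  rewrite eqxx /= in H.
  have [B0|B0] := eqVneq B 0.
    rewrite B0 eqxx /= in H.
    exists D => //; exists None; split=> /=; rewrite ?B0; ring.
  exists (- B); first by rewrite oppr_eq0.
  by exists (Some (- (D / B))); split=> /=; field.
Qed.

Lemma on_curve_fibre0 (C : numClosedFieldType) (a : correspondence C) y x :
  ~~ fibre_neq0 a y -> on_curve a (x, y).
Proof.
rewrite /fibre_neq0 !negb_or !negbK /on_curve biformE /=.
by case/and3P=> /eqP-> /eqP-> /eqP->; rewrite !mul0r !addr0.
Qed.

(** The points 0, 1 and oo are distinct, so a fibre given by a pair is not the whole line and its
    form is nonzero. *)
Lemma P1_not_pair (C : numClosedFieldType) (p q : P1 C) :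
  ~ (forall x, x = p \/ x = q).
Proof.
have n01 : Some (0 : C) <> Some 1 by case=> /eqP; rewrite eq_sym oner_eq0.
rewrite /P1 in p q *.
by move=> E; case: (E None) (E (Some 0)) (E (Some 1)) => ? [] ? [] ?;
  try congruence; case: n01; etransitivity; eauto.
Qed.

Lemma factored_fibre_neq0 (C : numClosedFieldType) (a : correspondence C)
  y c p q : c != 0 -> factored a y c p q -> fibre_neq0 a y.
Proof.
move=> c0 F; apply/negPn/negP=> /on_curve_fibre0 H.
by apply: (@P1_not_pair _ p q) => x; apply/(factored_on_curve c0 F).
Qed.

(** A nonzero form with a root at [p.1] splits, and its zero set then determines the other root. The
    set-theoretic switch thus becomes an identity between coefficients, from which formulas for the
    image follow. *)
Lemma hswitchE (C : numClosedFieldType) (a : correspondence C) p q :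
  hswitch a p q <->
  q.2 = p.2 /\ exists2 c, c != 0 & factored a p.2 c p.1 q.1.
Proof.
rewrite /hswitch; split=> -[-> H]; split=> //; last first.
  by case: H => c c0 F; apply: factored_on_curve F.
have F : fibre_neq0 a p.2.
  apply/negPn/negP=> /on_curve_fibre0 H0.
  by apply: (@P1_not_pair _ p.1 q.1) => x; apply/H.
have [c c0 [r Fr]] := on_curve_factored F ((H _).2 (or_introl erefl)).
by exists c; rewrite // (pair_set_fun H (factored_on_curve c0 Fr)).
Qed.

Lemma hswitch_sym (C : numClosedFieldType) (a : correspondence C) p q :
  hswitch a p q -> hswitch a q p.
Proof. by case=> e H; split=> // x; rewrite e H; split=> -[]; auto. Qed.

Lemma hswitch_fun (C : numClosedFieldType) (a : correspondence C) p q q' :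
  hswitch a p q -> hswitch a p q' -> q = q'.
Proof.
case: q q' => [q1 q2] [r1 r2] [/= -> H] [/= -> H'].
by rewrite (pair_set_fun H H').
Qed.

Lemma hswitch_on_curve (C : numClosedFieldType) (a : correspondence C) p q :
  hswitch a p q -> on_curve a p /\ on_curve a q.
Proof.
by case: p q => [p1 p2] [q1 q2] [/= -> H]; split; apply/H; [left|right].
Qed.

(** * Vertical switches by transposition *)

Definition swap (C : numClosedFieldType) (p : P1 C * P1 C) : P1 C * P1 C :=
  (p.2, p.1).

Lemma on_curve_tr (C : numClosedFieldType) (a : correspondence C) p :
  on_curve a^T p <-> on_curve a (swap p).
Proof.
rewrite /on_curve /=; suff -> : biform a^T (hcoord p.1) (hcoord p.2)
          = biform a (hcoord p.2) (hcoord p.1) by [].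
rewrite /biform exchange_big /=; apply: eq_bigr => i _; apply: eq_bigr => j _.
by rewrite mxE mulrAC.
Qed.

Lemma vswitchE (C : numClosedFieldType) (a : correspondence C) p q :
  vswitch a p q <-> hswitch a^T (swap p) (swap q).
Proof.
case: p q => [p1 p2] [q1 q2]; split=> -[/= -> H]; split=> // y;
  by move: (H y) (on_curve_tr a (y, p1)); rewrite /swap /=; tauto.
Qed.

Lemma vswitch_sym (C : numClosedFieldType) (a : correspondence C) p q :
  vswitch a p q -> vswitch a q p.
Proof. by rewrite !vswitchE; apply: hswitch_sym. Qed.

Lemma vswitch_on_curve (C : numClosedFieldType) (a : correspondence C) p q :
  vswitch a p q -> on_curve a p /\ on_curve a q.
Proof. by case: p q => ? ? [? ?] /vswitchE/hswitch_on_curve; rewrite !on_curve_tr. Qed.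

(* As a relation between maps, h \delta^k h = \delta^(-k). *)
Lemma qrt_iter_conj (C : numClosedFieldType) (a : correspondence C) k p q q' :
  qrt_iter a k p q -> hswitch a q q' ->
  exists2 p', hswitch a p p' & qrt_iter a k q' p'.
Proof.
(* [qrt_iter] unfolds its first step, while the reversed path grows at its end. *)
have snoc j x y z : qrt_iter a j x y -> qrt a y z -> qrt_iter a j.+1 x z.
  elim: j x => [|j IHj] x /=; first by move=> -> ?; exists z.
  by case=> m xm my yz; exists m => //; apply: IHj yz.
move=> + qq'; elim: k p => [|k IHk] p; first by move=> /= <-; exists q'.
case=> m [m1 pm1 m1m] /IHk[m' mm' q'm']; exists m1 => //.
apply: snoc q'm' _; exists m; [exact: hswitch_sym|exact: vswitch_sym].
Qed.

Lemma qrt_iter_on_curve (C : numClosedFieldType) (a : correspondence C) k p q :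
  on_curve a p -> qrt_iter a k p q -> on_curve a q.
Proof.
elim: k p => [|k IHk] p Hp /=; first by move=> ->.
by case=> m [r _ /vswitch_on_curve[_ Hm]]; apply: IHk.
Qed.

(** * Compatibility with the central symmetry *)

Lemma hswitch_central_sym (C : numClosedFieldType) (a22 a11 a20 a02 a00 : C) p q :
  hswitch (primary a22 a11 a20 a02 a00) p q ->
  hswitch (primary a22 a11 a20 a02 a00) (central_sym p) (central_sym q).
Proof.
have NN (x : P1 C) : omap -%R (omap -%R x) = x by case: x => //= x; rewrite opprK.
have P r : on_curve (primary a22 a11 a20 a02 a00) (central_sym r) <->
    on_curve (primary a22 a11 a20 a02 a00) r.
  split; last exact: primary_central_sym.
  by move/primary_central_sym; rewrite /central_sym /= !NN -surjective_pairing.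
case: p q => [p1 p2] [q1 q2] [/= -> H]; split=> //= x.
rewrite -P /central_sym /= NN H.
by split=> -[] E; [left|right|left|right]; rewrite -?E ?NN // E NN.
Qed.

Lemma primary_tr (C : numClosedFieldType) (a22 a11 a20 a02 a00 : C) :
  (primary a22 a11 a20 a02 a00)^T = primary a22 a11 a02 a20 a00.
Proof.
apply/matrixP=> i j; rewrite !mxE.
by case: i j => [[|[|[|//]]] ?] [[|[|[|//]]] ?].
Qed.

Lemma secondary_tr (C : numClosedFieldType) (a22 a11 a20 a02 a00 : C) :
  (secondary a22 a11 a20 a02 a00)^T = secondary a22 a11 a02 a20 a00.
Proof.
apply/matrixP=> i j; rewrite !mxE.
by case: i j => [[|[|[|//]]] ?] [[|[|[|//]]] ?] //=; ring.
Qed.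

Lemma qrt_iter_central_sym (C : numClosedFieldType) (a22 a11 a20 a02 a00 : C) k p q :
  qrt_iter (primary a22 a11 a20 a02 a00) k p q ->
  qrt_iter (primary a22 a11 a20 a02 a00) k (central_sym p) (central_sym q).
Proof.
elim: k p => [|k IHk] p /=; first by move=> ->.
case=> m [r pr rm] /IHk mq; exists (central_sym m) => //.
exists (central_sym r); first exact: hswitch_central_sym.
by move: rm; rewrite !vswitchE primary_tr; apply: hswitch_central_sym.
Qed.

(** * The squaring map onto the secondary curve *)

Definition sqP1 (C : numClosedFieldType) (x : P1 C) : P1 C :=
  omap (fun t => t ^+ 2) x.

Definition sqpair (C : numClosedFieldType) (p : P1 C * P1 C) : P1 C * P1 C :=
  (sqP1 p.1, sqP1 p.2).

Lemma hcoord_sq (C : numClosedFieldType) (x : P1 C) :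
  hcoord (sqP1 x) = ((hcoord x).1 ^+ 2, (hcoord x).2 ^+ 2).
Proof. by case: x => [x|] /=; rewrite ?expr1n ?expr0n. Qed.

(** If the primary fibre is A x^2 + B x + D, the product of its values at x and -x is A^2 u^2 + (2 A
    D - B^2) u + D^2 with u = x^2: the secondary fibre has the squared roots. *)
Lemma hcoef_secondary (C : numClosedFieldType) (a22 a11 a20 a02 a00 : C) (y : P1 C) :
  let h i := hcoef (primary a22 a11 a20 a02 a00) i (hcoord y) in
  let h' i := hcoef (secondary a22 a11 a20 a02 a00) i (hcoord (sqP1 y)) in
  [/\ h' i2 = h i2 ^+ 2, h' i1 = 2 * h i2 * h i0 - h i1 ^+ 2
    & h' i0 = h i0 ^+ 2].
Proof. by rewrite /= !hcoefE hcoord_sq !mxE /=; split; ring. Qed.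

Lemma biform_secondary (C : numClosedFieldType) (a22 a11 a20 a02 a00 : C)
    (x y : P1 C) :
  biform (secondary a22 a11 a20 a02 a00) (hcoord (sqP1 x)) (hcoord (sqP1 y)) =
  biform (primary a22 a11 a20 a02 a00) (hcoord x) (hcoord y)
  * biform (primary a22 a11 a20 a02 a00) (hcoord (omap -%R x)) (hcoord y).
Proof.
have [H2 H1 H0] := hcoef_secondary a22 a11 a20 a02 a00 y.
rewrite !biformE H2 H1 H0 hcoord_sq.
by case: x => [x|] /=; ring.
Qed.

Lemma on_curve_sq (C : numClosedFieldType) (a22 a11 a20 a02 a00 : C) p :
  on_curve (primary a22 a11 a20 a02 a00) p ->
  on_curve (secondary a22 a11 a20 a02 a00) (sqpair p).
Proof. by rewrite /on_curve biform_secondary => ->; rewrite mul0r. Qed.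

Lemma on_curve_sq_lift (C : numClosedFieldType) (a22 a11 a20 a02 a00 : C) u :
  on_curve (secondary a22 a11 a20 a02 a00) u ->
  exists2 p, on_curve (primary a22 a11 a20 a02 a00) p & sqpair p = u.
Proof.
have sqK (z : P1 C) : exists x, sqP1 x = z.
  by case: z => [z|]; [exists (Some (sqrtC z)); rewrite /= sqrtCK|exists None].
case: u => [u v]; have [x <-] := sqK u; have [y <-] := sqK v.
rewrite /on_curve /= biform_secondary => /eqP; rewrite mulf_eq0.
case/orP=> /eqP H; [exists (x, y) => //|exists (omap -%R x, y) => //].
by rewrite /sqpair; case: x {H} => //= x; rewrite sqrrN.
Qed.

Lemma hswitch_sq (C : numClosedFieldType) (a22 a11 a20 a02 a00 : C) p q :
  hswitch (primary a22 a11 a20 a02 a00) p q ->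
  hswitch (secondary a22 a11 a20 a02 a00) (sqpair p) (sqpair q).
Proof.
case: p q => [p y] [q ?] /hswitchE [/= -> [c c0 [A B D]]].
apply/hswitchE; split=> //; exists (c ^+ 2); first by rewrite expf_neq0.
have [H2 H1 H0] := hcoef_secondary a22 a11 a20 a02 a00 y.
by split; rewrite /= ?H2 ?H1 ?H0 ?A ?B ?D !hcoord_sq /=; ring.
Qed.

(** A nonzero secondary form forces a nonzero primary form, so the primary switch is defined at [p];
    uniqueness of the secondary image then identifies its square with [u]. *)
Lemma hswitch_sq_lift (C : numClosedFieldType) (a22 a11 a20 a02 a00 : C) p u :
  on_curve (primary a22 a11 a20 a02 a00) p ->
  hswitch (secondary a22 a11 a20 a02 a00) (sqpair p) u ->
  exists2 q, hswitch (primary a22 a11 a20 a02 a00) p q & sqpair q = u.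
Proof.
case: p => [p y] Hp Hu.
have F : fibre_neq0 (primary a22 a11 a20 a02 a00) y.
  have [c c0 /(factored_fibre_neq0 c0)] := ((hswitchE _ _ _).1 Hu).2.
  have [H2 H1 H0] := hcoef_secondary a22 a11 a20 a02 a00 y.
  rewrite /fibre_neq0 /= H2 H1 H0 -!negb_and; apply: contra.
  by case/and3P=> /eqP-> /eqP-> /eqP->; rewrite expr0n mulr0 subrr eqxx.
have [c c0 [q Fq]] := on_curve_factored F Hp.
have Hq : hswitch (primary a22 a11 a20 a02 a00) (p, y) (q, y).
  by apply/hswitchE; split=> //; exists c.
by exists (q, y) => //; apply: hswitch_fun (hswitch_sq Hq) Hu.
Qed.

Lemma vswitch_sq (C : numClosedFieldType) (a22 a11 a20 a02 a00 : C) p q :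
  vswitch (primary a22 a11 a20 a02 a00) p q ->
  vswitch (secondary a22 a11 a20 a02 a00) (sqpair p) (sqpair q).
Proof.
by rewrite !vswitchE primary_tr secondary_tr; apply: hswitch_sq.
Qed.

Lemma vswitch_sq_lift (C : numClosedFieldType) (a22 a11 a20 a02 a00 : C) p u :
  on_curve (primary a22 a11 a20 a02 a00) p ->
  vswitch (secondary a22 a11 a20 a02 a00) (sqpair p) u ->
  exists2 q, vswitch (primary a22 a11 a20 a02 a00) p q & sqpair q = u.
Proof.
case: p u => [p1 p2] [u1 u2] Hp; rewrite vswitchE secondary_tr => Hu.
have Hp' : on_curve (primary a22 a11 a02 a20 a00) (p2, p1).
  by rewrite -primary_tr on_curve_tr.
have [[q2 q1] Hq [E2 E1]] := hswitch_sq_lift Hp' Hu.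
exists (q1, q2); last by rewrite /sqpair /= E1 E2.
by rewrite vswitchE primary_tr.
Qed.

Lemma qrt_iter_sq (C : numClosedFieldType) (a22 a11 a20 a02 a00 : C) k p q :
  qrt_iter (primary a22 a11 a20 a02 a00) k p q ->
  qrt_iter (secondary a22 a11 a20 a02 a00) k (sqpair p) (sqpair q).
Proof.
elim: k p => [|k IHk] p /=; first by move=> ->.
case=> m [r /hswitch_sq pr /vswitch_sq rm] /IHk mq.
by exists (sqpair m) => //; exists (sqpair r).
Qed.

(** Definedness passes up: if the secondary curve is k-periodic, the k-th iterate is defined on the
    whole primary curve. *)
Lemma qrt_iter_sq_lift (C : numClosedFieldType) (a22 a11 a20 a02 a00 : C) k p u :
  on_curve (primary a22 a11 a20 a02 a00) p ->
  qrt_iter (secondary a22 a11 a20 a02 a00) k (sqpair p) u ->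
  exists2 q, qrt_iter (primary a22 a11 a20 a02 a00) k p q & sqpair q = u.
Proof.
elim: k p => [|k IHk] p Hp /=; first by move=> ->; exists p.
case=> m [r /(hswitch_sq_lift Hp)[r' pr <-]].
have [_ Hr] := hswitch_on_curve pr.
case/(vswitch_sq_lift Hr)=> m' rm <-.
have [_ Hm] := vswitch_on_curve rm.
case/(IHk _ Hm)=> q mq <-; exists q => //.
by exists m' => //; exists r'.
Qed.

(** * Polynomial functions on the double cover *)

(* The functions on the double cover s^2 = D(eta) induced by polynomials in
   (eta, s). *)
Definition regular (C : numClosedFieldType) (D : {poly C}) (f : C * C -> C) :
    Prop :=
  exists f0 f1 : {poly C}, forall t, t.2 ^+ 2 = D.[t.1] ->
    f t = f0.[t.1] + f1.[t.1] * t.2.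

Definition regular2 (C : numClosedFieldType) (D : {poly C})
    (X : C * C -> C * C) : Prop :=
  regular D (fun t => (X t).1) /\ regular D (fun t => (X t).2).

Lemma regular_poly (C : numClosedFieldType) (D g : {poly C}) :
  regular D (fun t => g.[t.1]).
Proof. by exists g, 0 => t _; rewrite horner0 mul0r addr0. Qed.

Lemma regular_const (C : numClosedFieldType) (D : {poly C}) c :
  regular D (fun=> c).
Proof. by exists c%:P, 0 => t _; rewrite !hornerE. Qed.

Lemma regular_snd (C : numClosedFieldType) (D : {poly C}) :
  regular D (fun t => t.2).
Proof. by exists 0, 1 => t _; rewrite !hornerE. Qed.

Lemma regularD (C : numClosedFieldType) (D : {poly C}) f g :
  regular D f -> regular D g -> regular D (fun t => f t + g t).
Proof.
case=> f0 [f1 Hf] [g0 [g1 Hg]]; exists (f0 + g0), (f1 + g1) => t Ht.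
by rewrite Hf // Hg // !hornerD; ring.
Qed.

Lemma regularM (C : numClosedFieldType) (D : {poly C}) f g :
  regular D f -> regular D g -> regular D (fun t => f t * g t).
Proof.
case=> f0 [f1 Hf] [g0 [g1 Hg]].
exists (f0 * g0 + f1 * g1 * D), (f0 * g1 + f1 * g0) => t Ht.
by rewrite Hf // Hg // !(hornerD, hornerM) -Ht; ring.
Qed.

Lemma regularN (C : numClosedFieldType) (D : {poly C}) f :
  regular D f -> regular D (fun t => - f t).
Proof.
case=> f0 [f1 Hf]; exists (- f0), (- f1) => t Ht.
by rewrite Hf // !hornerN; ring.
Qed.

Lemma eq_regular (C : numClosedFieldType) (D : {poly C}) f g :
  f =1 g -> regular D g -> regular D f.
Proof. by move=> E [g0 [g1 H]]; exists g0, g1 => t Ht; rewrite E H. Qed.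

Lemma regular_hcoef (C : numClosedFieldType) (D : {poly C})
    (a : correspondence C) i Y :
  regular2 D Y -> regular D (fun t => hcoef a i (Y t)).
Proof.
case=> Y1 Y2; rewrite /hcoef.
have RX f n : regular D f -> regular D (fun t => f t ^+ n).
  move=> Rf; elim: n => [|n IHn]; first exact: regular_const.
  exact: eq_regular (fun t => exprS _ _) (regularM Rf IHn).
suff R (s : seq 'I_3) : regular D (fun t =>
    \sum_(j <- s) a i j * ((Y t).1 ^+ j * (Y t).2 ^+ (2 - j))) by apply: R.
elim: s => [|j s IHs].
  exact: eq_regular (fun t => big_nil _ _ _ _) (regular_const _ 0).
apply: eq_regular (fun t => big_cons _ _ _ _ _ _) _ => /=.
apply: regularD IHs; apply: regularM (regular_const _ _) _.
by apply: regularM; apply: RX.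
Qed.

(** * Projective representatives and local formulas for the iterates *)

(* Here v may be (0, 0), which represents every point. *)
Definition rep (C : numClosedFieldType) (v : C * C) (x : P1 C) : Prop :=
  exists l, v = scal l (hcoord x).

Definition srep (C : numClosedFieldType) (v : C * C) (x : P1 C) : Prop :=
  exists2 l, l != 0 & v = scal l (hcoord x).

Lemma srep_rep (C : numClosedFieldType) (v : C * C) (x : P1 C) :
  srep v x -> rep v x.
Proof. by case=> l _ ->; exists l. Qed.

Lemma rep_cross (C : numClosedFieldType) (v w : C * C) (x : P1 C) :
  rep v x -> rep w x -> cross v w = 0.
Proof. by case=> l -> [m ->]; rewrite /cross /=; ring. Qed.

Lemma srep_cross (C : numClosedFieldType) (v w : C * C) (x y : P1 C) :
  srep v x -> srep w y -> x <> y -> cross v w != 0.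
Proof.
case=> l l0 -> [m m0 ->] xy.
have -> : cross (scal l (hcoord x)) (scal m (hcoord y))
          = l * m * cross (hcoord x) (hcoord y).
  by rewrite /cross /=; ring.
rewrite !mulf_neq0 //; apply/eqP=> H; exact/xy/cross_hcoord.
Qed.

(* The sum and the product of the two roots of the fibre give two formulas for
   the second root; each one is a multiple of that root, and at every point of
   the curve one of the two is nonzero. *)
Definition hstep (C : numClosedFieldType) (a : correspondence C) (b : bool)
    (v w : C * C) : C * C :=
  if b then (- (hcoef a i1 w * v.2 + hcoef a i2 w * v.1), hcoef a i2 w * v.2)
  else (hcoef a i0 w * v.1, - (hcoef a i1 w * v.1 + hcoef a i0 w * v.2)).

Lemma hcoef_scal (C : numClosedFieldType) (a : correspondence C) i l y :
  hcoef a i (scal l y) = l ^+ 2 * hcoef a i y.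
Proof. by rewrite !hcoefE /=; ring. Qed.

Lemma hstepE (C : numClosedFieldType) (a : correspondence C) p q :
  hswitch a p q -> exists2 c, c != 0 & forall b l m,
  hstep a b (scal l (hcoord p.1)) (scal m (hcoord p.2)) =
  scal (m ^+ 2 * l * c
        * (if b then (hcoord p.1).2 else (hcoord p.1).1) ^+ 2) (hcoord q.1).
Proof.
case/hswitchE=> _ [c c0 [A B D]]; exists c => // b l m.
rewrite /hstep !hcoef_scal A B D /scal /=.
by case: b; congr pair; ring.
Qed.

Lemma regular_hstep (C : numClosedFieldType) (D : {poly C})
    (a : correspondence C) b X Y :
  regular2 D X -> regular2 D Y -> regular2 D (fun t => hstep a b (X t) (Y t)).
Proof.
case=> X1 X2 RY; have RH i := regular_hcoef a i RY.
by case: b; split=> /=;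
  repeat first [apply: regularN | apply: regularD | apply: regularM].
Qed.

(** The formula is selected by a nonzero coordinate of [p.1] at [t0] and kept for all parameters;
    where it degenerates it returns (0, 0), which [rep] allows. *)
Lemma hswitch_local (C : numClosedFieldType) (D : {poly C})
    (a : correspondence C) p q t0 X Y :
  hswitch a p q -> regular2 D X -> regular2 D Y ->
  srep (X t0) p.1 -> srep (Y t0) p.2 ->
  exists X', [/\ regular2 D X', srep (X' t0) q.1 &
    forall t p' q', rep (X t) p'.1 -> rep (Y t) p'.2 -> hswitch a p' q' ->
      rep (X' t) q'.1].
Proof.
move=> H RX RY [l l0 El] [m m0 Em].
exists (fun t => hstep a ((hcoord p.1).2 != 0) (X t) (Y t)); split.
- exact: regular_hstep.
- have [c c0 E] := hstepE H; rewrite El Em E.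
  eexists; last by [].
  by rewrite !mulf_neq0 ?expf_neq0 ?hcoord_pick.
- move=> t p' q' [l' ->] [m' ->] /hstepE[c c0 E]; rewrite E.
  by eexists.
Qed.

(** Horizontal and vertical steps replace X and Y in turn. The result represents the iterate
    strictly at [t0], and weakly at every parameter over which the iterate is defined. *)
Lemma qrt_iter_local (C : numClosedFieldType) (D : {poly C})
    (a : correspondence C) k p q t0 X Y :
  qrt_iter a k p q -> regular2 D X -> regular2 D Y ->
  srep (X t0) p.1 -> srep (Y t0) p.2 ->
  exists X' Y', [/\ regular2 D X' /\ regular2 D Y',
    srep (X' t0) q.1 /\ srep (Y' t0) q.2 &
    forall t p' q', rep (X t) p'.1 -> rep (Y t) p'.2 -> qrt_iter a k p' q' ->
      rep (X' t) q'.1 /\ rep (Y' t) q'.2].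
Proof.
elim: k p X Y => [|k IHk] p X Y.
  by move=> /= -> RX RY SX SY; exists X, Y; split=> // t p' q' ? ? ->.
case=> m [r pr rm] mq RX RY SX SY.
have [X1 [RX1 SX1 H1]] := hswitch_local pr RX RY SX SY.
have SY1 : srep (Y t0) r.2 by case: pr => ->.
have [Y1 [RY1 SY2 H2]] := hswitch_local ((vswitchE _ _ _).1 rm) RY RX1 SY1 SX1.
have SX2 : srep (X1 t0) m.1 by case: rm => ->.
have [X' [Y' [R S H]]] := IHk _ _ _ mq RX1 RY1 SX2 SY2.
exists X', Y'; split=> // t p' q' Hp1 Hp2 [m' [r' p'r' r'm'] /H]; apply.
  by case: (r'm') => -> _; apply: H1 p'r'.
apply: (H2 t (swap r') (swap m')); rewrite /swap /=.
- by case: p'r' => ->.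
- exact: H1 p'r'.
- exact/vswitchE.
Qed.

(** * The two affine charts and the parametrised fibre roots *)

Definition chart (C : numClosedFieldType) (b : bool) (n : C) : C * C :=
  if b then (n, 1) else (1, n).

Definition chart_coef (C : numClosedFieldType) (a : correspondence C)
    (b : bool) (i : 'I_3) : {poly C} :=
  let y := if b then ('X, 1) else (1, 'X) in
  (a i i0)%:P * y.2 ^+ 2 + (a i i1)%:P * (y.1 * y.2) + (a i i2)%:P * y.1 ^+ 2.

Lemma chart_coefE (C : numClosedFieldType) (a : correspondence C) b i n :
  (chart_coef a b i).[n] = hcoef a i (chart b n).
Proof. by rewrite hcoefE /chart_coef /chart; case: b; rewrite /= !hornerE /=; ring. Qed.

Definition chart_disc (C : numClosedFieldType) (a : correspondence C)
    (b : bool) : {poly C} :=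
  chart_coef a b i1 ^+ 2 - 4%:R *: (chart_coef a b i2 * chart_coef a b i0).

(* The root (- B + s) / (2 A) = 2 D / (- B - s) of A x^2 + B x + D, in
   homogeneous coordinates. *)
Definition fibre_root (C : numClosedFieldType) (a : correspondence C)
    (b b' : bool) (t : C * C) : C * C :=
  let A := hcoef a i2 (chart b t.1) in let B := hcoef a i1 (chart b t.1) in
  let D := hcoef a i0 (chart b t.1) in
  if b' then (- B + t.2, 2 * A) else (2 * D, - B - t.2).

Lemma regular_chart (C : numClosedFieldType) (D : {poly C}) b :
  regular2 D (fun t => chart b t.1).
Proof.
have RX : regular D (fun t => t.1).
  by have [f0 [f1 H]] := regular_poly D 'X; exists f0, f1 => t /H <-; rewrite hornerX.
by case: b; split=> //=; apply: regular_const.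
Qed.

Lemma regular_fibre_root (C : numClosedFieldType) (D : {poly C})
    (a : correspondence C) b b' :
  regular2 D (fibre_root a b b').
Proof.
have RH i := regular_hcoef a i (regular_chart D b).
by rewrite /fibre_root; case: b'; split=> /=;
  repeat first [apply: regularN | apply: regularD | apply: regularM
               | apply: RH | apply: regular_snd | apply: regular_const].
Qed.

(** On the cover, the horizontal switch is the sign change of s: the same formula represents [p.1]
    at s and [m.1] at - s. *)
Lemma fibre_rootE (C : numClosedFieldType) (a : correspondence C) b n p m :
  hswitch a p m -> srep (chart b n) p.2 ->
  exists s, [/\ s ^+ 2 = (chart_disc a b).[n],
    exists b', srep (fibre_root a b b' (n, s)) p.1 &
    forall b', rep (fibre_root a b b' (n, s)) p.1
               /\ rep (fibre_root a b b' (n, - s)) m.1].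
Proof.
case/hswitchE=> _ [c c0 [A B D]] [l l0 El].
set v := hcoord p.1 in A B D *; set w := hcoord m.1 in A B D *.
(* For finite roots this is the leading coefficient times their difference: the square root of the
   discriminant whose sign picks [p]. *)
pose s := l ^+ 2 * c * (v.1 * w.2 - v.2 * w.1); exists s.
have E b' : fibre_root a b b' (n, s)
    = scal (2 * l ^+ 2 * c * (if b' then w.2 else w.1)) v.
  rewrite /fibre_root /= El !hcoef_scal A B D /scal /s /=.
  by case: b'; congr pair; ring.
have E' b' : fibre_root a b b' (n, - s)
    = scal (2 * l ^+ 2 * c * (if b' then v.2 else v.1)) w.
  rewrite /fibre_root /= El !hcoef_scal A B D /scal /s /=.
  by case: b'; congr pair; ring.
split.
- rewrite /chart_disc hornerD hornerN hornerZ horner_exp hornerM.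
  rewrite !chart_coefE El !hcoef_scal A B D /s.
  ring.
(* The scalar in [E] contains a coordinate of the other point [m], so [m] decides which formula is
   nondegenerate at [p]. *)
- exists (w.2 != 0); rewrite E; eexists; last by [].
  by rewrite !mulf_neq0 ?expf_neq0 ?pnatr_eq0 ?hcoord_pick.
- by move=> b'; rewrite E E'; split; eexists.
Qed.

(** * Finiteness of the fibres on which the iterate is a given scaling *)

Definition act (C : numClosedFieldType) (e : C) (p : P1 C * P1 C) :
    P1 C * P1 C :=
  (omap ( *%R e) p.1, omap ( *%R e) p.2).

Lemma rep_act (C : numClosedFieldType) (e : C) v x :
  rep v x -> rep (e * v.1, v.2) (omap ( *%R e) x).
Proof.
case=> l ->; case: x => [x|]; [exists l|exists (e * l)]; rewrite /scal /=;
  congr pair; ring.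
Qed.

Lemma srep_act (C : numClosedFieldType) (e : C) v x :
  e != 0 -> srep v x -> srep (e * v.1, v.2) (omap ( *%R e) x).
Proof.
move=> e0 [l l0 ->]; case: x => [x|]; [exists l|exists (e * l)];
  rewrite ?mulf_neq0 /scal //=; congr pair; ring.
Qed.

(** Adding the values on the two sheets gives f0(n) = 0, and multiplying the remaining term by s
    gives f1(n) D(n) = 0, so n is a root of a fixed nonzero polynomial. *)
Lemma regular_zeros_finite (C : numClosedFieldType) (D : {poly C}) f t0 :
  regular D f -> t0.2 ^+ 2 = D.[t0.1] -> f t0 != 0 ->
  exists r : seq C, forall n s, s ^+ 2 = D.[n] ->
    f (n, s) = 0 -> f (n, - s) = 0 -> n \in r.
Proof.
case=> f0 [f1 Hf] Ht0 F0.
(* If f0 = 0, then f1 and s are nonzero at [t0], hence so is D, and f1 * D is not the zero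
   polynomial. *)
pose g := if f0 == 0 then f1 * D else f0.
have g0 : g != 0.
  rewrite /g; case: (f0 =P 0) => [E|/eqP//]; move: F0; rewrite Hf // E horner0 add0r.
  rewrite mulf_eq0 negb_or => /andP[f1n0 s0].
  rewrite mulf_neq0 //; first by apply: contraNneq f1n0 => ->; rewrite horner0.
  apply: contraNneq s0 => D0; move/eqP: Ht0.
  by rewrite D0 horner0 expf_eq0.
have [r Er] := closed_field_poly_normal g; exists r => n s Hs.
rewrite !Hf ?sqrrN //= => E1 E2.
have Z0 : f0.[n] = 0.
  apply/eqP; rewrite -(mulrI_eq0 _ (lregP (_ : (2 : C) != 0))) ?pnatr_eq0 //.
  have -> : 2 * f0.[n] = (f0.[n] + f1.[n] * s) + (f0.[n] + f1.[n] * - s) by ring.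
  by rewrite E1 E2 addr0.
have Z1 : f1.[n] * D.[n] = 0.
  rewrite -Hs; have -> : f1.[n] * s ^+ 2 = (f0.[n] + f1.[n] * s - f0.[n]) * s.
    by ring.
  by rewrite E1 Z0 subrr mul0r.
have : root g n by rewrite /root /g; case: ifP; rewrite ?hornerM ?Z0 ?Z1 eqxx.
by rewrite Er rootZ ?lead_coef_eq0 // root_prod_XsubC.
Qed.

(** This is the finiteness of S_e, for e = 1 and e = -1 at once. As S_e is closed under the
    horizontal switch, a regular function vanishing on it vanishes on both sheets over each of its
    fibres. *)
Lemma qrt_iter_act_finite (C : numClosedFieldType) (a : correspondence C)
    (e : C) k p0 m0 q0 :
  e != 0 ->
  (forall p p', hswitch a p p' -> qrt_iter a k p (act e p) ->
     qrt_iter a k p' (act e p')) ->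
  hswitch a p0 m0 -> qrt_iter a k p0 q0 -> q0 <> act e p0 ->
  exists r : seq C, forall x y m, hswitch a (x, Some y) m ->
    qrt_iter a k (x, Some y) (act e (x, Some y)) -> y \in r.
Proof.
move=> e0 Hinv Hm0 Hq0 nq0.
have [b [n0 Sn0]] : exists b n0, srep (chart b n0) p0.2.
  case: (p0.2) => [y|]; [exists true, y|exists false, 0]; exists 1;
    by rewrite ?oner_neq0 // /scal /= !mul1r.
have [s0 [Es0 [b' SX] _]] := fibre_rootE Hm0 Sn0.
set D := chart_disc a b in Es0.
pose X := fibre_root a b b'; pose Y (t : C * C) := chart b t.1.
have RX : regular2 D X by apply: regular_fibre_root.
have RY : regular2 D Y by apply: regular_chart.
have [X' [Y' [[RX' RY'] [SX' SY'] H]]] :=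
  @qrt_iter_local _ D _ _ _ _ (n0, s0) X Y Hq0 RX RY SX Sn0.
(* The function f compares the iterate with the scaled point in a coordinate where they differ at
   [p0]; it vanishes wherever they agree. *)
have [f [Rf Ff Zf]] : exists f, [/\ regular D f, f (n0, s0) != 0 &
    forall t p, rep (X t) p.1 -> rep (Y t) p.2 ->
      qrt_iter a k p (act e p) -> f t = 0].
  have RC V W : regular2 D V -> regular2 D W ->
      regular D (fun t => cross (V t) (e * (W t).1, (W t).2)).
    case=> V1 V2 [W1 W2]; rewrite /cross /=.
    by repeat first [apply: regularN | apply: regularD | apply: regularM
                    | apply: regular_const].
  have [E1|E1] := eqVneq q0.1 (act e p0).1.
    exists (fun t => cross (Y' t) (e * (Y t).1, (Y t).2)); split.
    - exact: RC.
    - apply: srep_cross SY' (srep_act e0 Sn0) _ => E2; apply: nq0.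
      by rewrite (surjective_pairing q0) E1 E2.
    - move=> t p Xp Yp /(H _ _ _ Xp Yp)[_ Hp]; exact: rep_cross Hp (rep_act e Yp).
  exists (fun t => cross (X' t) (e * (X t).1, (X t).2)); split.
  - exact: RC.
  - by apply: srep_cross SX' (srep_act e0 SX) _; apply/eqP.
  - move=> t p Xp Yp /(H _ _ _ Xp Yp)[Hp _]; exact: rep_cross Hp (rep_act e Xp).
have [r Hr] := @regular_zeros_finite _ _ _ (n0, s0) Rf Es0 Ff.
(* The list [r] holds chart parameters. In the chart at infinity they are inverses of heights, and
   the height 0, which that chart misses, is added by hand. *)
exists (0 :: (if b then r else map GRing.inv r)) => x y m Hm Hp.
rewrite inE; have [//|y0 /=] := eqVneq y 0.
pose n := if b then y else y^-1.
have Sn : srep (chart b n) (Some y).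
  rewrite /n; case: (b); [exists 1|exists y^-1];
    by rewrite ?oner_neq0 ?invr_eq0 // /scal /= ?mul1r ?mulVf ?mulr1.
suff : n \in r.
  rewrite /n; case: (b) => // Hn.
  by apply/mapP; exists y^-1; rewrite // invrK.
have [s [Es _ /(_ b') [HX1 HX2]]] := fibre_rootE Hm Sn.
apply: Hr Es _ _; first exact: Zf (n, s) (x, Some y) HX1 (srep_rep Sn) Hp.
apply: (Zf (n, - s) m HX2); last exact: Hinv Hm Hp.
by case: Hm => -> _; apply: srep_rep.
Qed.

(** * Points of the curve and fibres of the squaring map *)

Lemma on_curve_exists (C : numClosedFieldType) (a : correspondence C) y :
  exists x, on_curve a (x, y).
Proof.
rewrite /on_curve /=; set w := hcoord y.
have [A0|A0] := eqVneq (hcoef a i2 w) 0.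
  by exists None; rewrite biformE /= A0; ring.
set A := hcoef a i2 w in A0; set B := hcoef a i1 w; set D := hcoef a i0 w.
pose s := sqrtC (B ^+ 2 - 4 * A * D).
exists (Some ((- B + s) / (2 * A))); rewrite biformE /= -/A -/B -/D.
have -> : D = (B ^+ 2 - s ^+ 2) / (4 * A) by rewrite sqrtCK; field.
by field.
Qed.

Lemma exists_notin (C : numClosedFieldType) (r : seq C) : exists y, y \notin r.
Proof.
have U : uniq [seq n%:R : C | n <- iota 0 (size r).+1].
  rewrite map_inj_uniq ?iota_uniq // => m n /eqP.
  by rewrite eqr_nat => /eqP.
have : ~~ all (mem r) [seq n%:R : C | n <- iota 0 (size r).+1].
  apply/negP=> /allP/(uniq_leq_size U).
  by rewrite size_map size_iota ltnn.
by case/allPn=> y _ Hy; exists y.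
Qed.

Lemma sqP1_eq (C : numClosedFieldType) (x z : P1 C) :
  sqP1 z = sqP1 x -> z = x \/ z = omap -%R x.
Proof.
case: x z => [x|] [z|] //=; last by left.
by case=> /eqP; rewrite eqf_sqr => /orP[] /eqP ->; [left|right].
Qed.

(** Subtracting the equations at (z, w) and (-z, w) leaves 2 a11 z w = 0. So if only one coordinate
    changes sign, some coordinate is fixed by negation (0 or oo), and the change amounts to the
    identity or to the central symmetry. *)
Lemma primary_sqpair_eq (C : numClosedFieldType) (a22 a11 a20 a02 a00 : C) p q :
  a11 != 0 ->
  on_curve (primary a22 a11 a20 a02 a00) p ->
  on_curve (primary a22 a11 a20 a02 a00) q -> sqpair q = sqpair p ->
  q = p \/ q = central_sym p.
Proof.
move=> a110; case: p q => [x y] [x' y'].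
have K (z w : P1 C) : on_curve (primary a22 a11 a20 a02 a00) (z, w) ->
    on_curve (primary a22 a11 a20 a02 a00) (omap -%R z, w) ->
    omap -%R z = z \/ omap -%R w = w.
  case: z w => [z|] [w|] //; [|by right|by left|by left].
  rewrite !primaryE => H1 H2.
  have : 2 * (a11 * (z * w)) = 0.
    by rewrite -[RHS](subrr 0) -[X in X - _]H1 -[X in _ - X]H2; ring.
  move/eqP; rewrite !mulf_eq0 pnatr_eq0 (negPf a110) /=.
  by case/orP=> /eqP ->; [left|right]; rewrite /= oppr0.
move=> Hp Hq [/sqP1_eq[] Ex /sqP1_eq[] Ey]; subst x' y'; [by left| | |by right].
  have := primary_central_sym Hq.
  rewrite /central_sym /=; have -> : omap -%R (omap -%R y) = y.
    by case: (y) => //= t; rewrite opprK.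
  by case/(K _ _ Hp)=> ->; [right|left].
by case: (K _ _ Hp Hq) => E; [left|right]; rewrite /central_sym /= E.
Qed.

Lemma central_sym_moves (C : numClosedFieldType) (a22 a11 a20 a02 a00 : C) :
  exists2 p, on_curve (primary a22 a11 a20 a02 a00) p & p <> central_sym p.
Proof.
have [x Hx] := on_curve_exists (primary a22 a11 a20 a02 a00) (Some 1).
exists (x, Some 1) => // -[_ /eqP].
by rewrite -subr_eq0 opprK -mulr2n pnatr_eq0.
Qed.

Lemma central_symK (C : numClosedFieldType) :
  involutive (@central_sym C).
Proof.
have K (x : P1 C) : omap -%R (omap -%R x) = x by case: x => //= x; rewrite opprK.
by case=> x y; rewrite /central_sym /= !K.
Qed.

Lemma act1 (C : numClosedFieldType) (p : P1 C * P1 C) : act 1 p = p.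
Proof. by case: p => [[x|] [y|]]; rewrite /act /= ?mul1r. Qed.

Lemma actN1 (C : numClosedFieldType) (p : P1 C * P1 C) :
  act (-1) p = central_sym p.
Proof. by case: p => [[x|] [y|]]; rewrite /act /central_sym /= ?mulN1r. Qed.

Lemma semi_periodic_secondary (C : numClosedFieldType)
    (a22 a11 a20 a02 a00 : C) k :
  semi_periodic (primary a22 a11 a20 a02 a00) k ->
  periodic (secondary a22 a11 a20 a02 a00) k.
Proof.
move=> H u /on_curve_sq_lift[p /H/qrt_iter_sq + <-].
suff -> : sqpair (central_sym p) = sqpair p by [].
have N (x : P1 C) : sqP1 (omap -%R x) = sqP1 x.
  by case: x => //= x; rewrite sqrrN.
by rewrite /sqpair /= !N.
Qed.

Theorem theorem6p23 (C : numClosedFieldType) (a22 a11 a20 a02 a00 : C)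
    (k : nat) (ha11 : a11 != 0) :
  semi_periodic (primary a22 a11 a20 a02 a00) k <->
  ~ periodic (primary a22 a11 a20 a02 a00) k
  /\ periodic (secondary a22 a11 a20 a02 a00) k.
Proof.
set a := primary a22 a11 a20 a02 a00.
split=> [H|[nP Hs]].
  split; last exact: semi_periodic_secondary.
  move=> P; have [p Hp] := central_sym_moves a22 a11 a20 a02 a00; apply.
  exact: qrt_iter_fun (P p Hp) (H p Hp).
(* The 0-th iterate is the identity, against [nP]. For k > 0 the first step of the iterate provides
   the switch needed in [defined]. *)
case: k nP Hs => [|k] nP Hs; first by case: nP.
set K := k.+1 in nP Hs *.
have dich p : on_curve a p -> qrt_iter a K p p \/ qrt_iter a K p (central_sym p).
  move=> Hp; have [q pq Eq] := qrt_iter_sq_lift Hp (Hs _ (on_curve_sq Hp)).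
  have Hq := qrt_iter_on_curve Hp pq.
  by case: (primary_sqpair_eq ha11 Hp Hq Eq) => E; rewrite E in pq; auto.
have defined p q : qrt_iter a K p q -> exists m, hswitch a p m.
  by case=> ? [m Hm _] _; exists m.
have inv1 p p' : hswitch a p p' ->
    qrt_iter a K p (act 1 p) -> qrt_iter a K p' (act 1 p').
  rewrite !act1 => pp' /qrt_iter_conj-/(_ _ pp')[p'' pp''].
  by rewrite (hswitch_fun pp'' pp').
have invN1 p p' : hswitch a p p' ->
    qrt_iter a K p (act (-1) p) -> qrt_iter a K p' (act (-1) p').
  rewrite !actN1 => pp' /qrt_iter_conj.
  (* Conjugation by the switch shows that the iterate takes -p' to p'; the central symmetry turns
     this into p' going to -p'. *)
  move/(_ _ (hswitch_central_sym pp'))=> [p'' pp''].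
  by rewrite (hswitch_fun pp'' pp') => /qrt_iter_central_sym; rewrite central_symK.
(* At points fixed by the symmetry the two alternatives coincide, so only moved points can
   conflict. *)
have both p q : qrt_iter a K p p -> qrt_iter a K q (central_sym q) ->
    p <> central_sym p -> q <> central_sym q -> False.
  move=> pp qq np nq.
  have [mp pm] := defined _ _ pp; have [mq qm] := defined _ _ qq.
  have [r Hr] : exists r : seq C, forall x y m, hswitch a (x, Some y) m ->
      qrt_iter a K (x, Some y) (act 1 (x, Some y)) -> y \in r.
    by apply: qrt_iter_act_finite inv1 qm qq _; rewrite ?oner_eq0 // act1 => /esym.
  have [r' Hr'] : exists r : seq C, forall x y m, hswitch a (x, Some y) m ->
      qrt_iter a K (x, Some y) (act (-1) (x, Some y)) -> y \in r.
    by apply: qrt_iter_act_finite invN1 pm pp _;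
      rewrite ?oppr_eq0 ?oner_eq0 // actN1.
  have [y] := exists_notin (r ++ r'); rewrite mem_cat negb_or => /andP[/negP Hy /negP Hy'].
  have [x Hx] := on_curve_exists a (Some y).
  case: (dich _ Hx) => H; have [m Hm] := defined _ _ H.
    by apply: Hy; apply: Hr Hm _; rewrite act1.
  by apply: Hy'; apply: Hr' Hm _; rewrite actN1.
(* If a moved [p] returns to itself, then by [both] no moved [q] goes to its opposite, so the curve
   is k-periodic, against [nP]. *)
move=> p Hp; have [pp|//] := dich p Hp.
have [Ep|/eqP np] := eqVneq (p : option C * option C) (central_sym p).
  by rewrite -Ep.
case: nP => q Hq; have [//|qq] := dich q Hq.
have [Eq|/eqP nq] := eqVneq (q : option C * option C) (central_sym q).
  by rewrite {2}Eq.
by case: (both p q).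
Qed.
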